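(* Let $A$ and $X$ be $d\times d$ real symmetric matrices, where $A$ has rank $r\le d$ and non-zero eigenvalues $\lambda_1\ge\cdots\ge\lambda_r$ (with multiplicity), with eigen-decomposition $A=\Theta\Lambda\Theta^{\mathsf T}=\sum_{j=1}^r\lambda_j\theta_j\theta_j^{\mathsf T}$, $\Theta=(\theta_1,\dots,\theta_r)\in\mathbb R^{d\times r}$, $\Theta^{\mathsf T}\Theta=I_r$. Let $\hat A=A+X$ and let $\hat\Theta\in\mathbb R^{d\times r}$ be the matrix whose columns are orthonormal eigenvectors of $\hat A$ associated with its $r$ largest eigenvalues in absolute value. If $\|X\|<\min_{1\le i\le r}\frac{|\lambda_i|}{2}$, then $$\hat\Theta\hat\Theta^{\mathsf T}-\Theta\Theta^{\mathsf T}=\sum_{k\ge 1}\mathcal S_{A,k}(X),$$ where for each $k\ge1$ $$\mathcal S_{A,k}(X)=\sum_{\mathbf s:\, s_1+\cdots+s_{k+1}=k}(-1)^{1+\tau(\mathbf s)}\,\mathfrak P^{-s_1}X\mathfrak P^{-s_2}X\cdots X\mathfrak P^{-s_{k+1}},$$ the sum being over all tuples $\mathbf s=(s_1,\dots,s_{k+1})$ of non-negative integers with $s_1+\cdots+s_{k+1}=k$.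
   Context: $\|\cdot\|$ is the operator (spectral) norm. $\Theta_\perp\in\mathbb R^{d\times(d-r)}$ is such that $(\Theta,\Theta_\perp)$ is orthogonal. $\mathfrak P^{0}:=\mathfrak P^{\perp}:=\Theta_\perp\Theta_\perp^{\mathsf T}$, and for integers $k\ge1$, $\mathfrak P^{-k}:=\Theta\Lambda^{-k}\Theta^{\mathsf T}=\sum_{j=1}^r\lambda_j^{-k}\theta_j\theta_j^{\mathsf T}$, with $\Lambda=\mathrm{diag}(\lambda_1,\dots,\lambda_r)$. $\tau(\mathbf s)=\sum_{j=1}^{k+1}\mathbb I(s_j>0)$ is the number of positive entries of $\mathbf s$. *)

(* Defs.v *)
From HB Require Import structures.
From mathcomp Require Import all_boot all_order all_algebra.
From mathcomp Require Import all_classical all_reals all_analysis.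

Set Implicit Arguments.
Unset Strict Implicit.
Unset Printing Implicit Defensive.

Import Order.TTheory GRing.Theory Num.Theory.
Import numFieldNormedType.Exports.

Local Open Scope classical_set_scope.
Local Open Scope ring_scope.

Definition l2norm (R : realType) (n : nat) (v : 'cV[R]_n) : R :=
  Num.sqrt (\sum_(i < n) v i 0 ^+ 2).

(* Spectral norm; the library's norm on matrices is the entrywise maximum. *)
Definition opnorm (R : realType) (m n : nat) (M : 'M[R]_(m, n)) : R :=
  sup [set l2norm (M *m v) | v in [set v : 'cV[R]_n | l2norm v <= 1]].

(* [row_mx T T'] has [r + (d - r)] columns, so both identities are stated. *)
Definition orthogonal_completion (R : realType) (d r : nat)
    (T : 'M[R]_(d, r)) (T' : 'M[R]_(d, d - r)) : Prop :=
  (row_mx T T')^T *m row_mx T T' = 1%:M /\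
  row_mx T T' *m (row_mx T T')^T = 1%:M.

(* The columns of [T] are orthonormal eigenvectors of [M] for its [r] largest
   eigenvalues in absolute value: the spectrum of [M], with multiplicity, is
   [mu] (one eigenvalue per column of [T]) together with [nu], and no entry of
   [nu] exceeds an entry of [mu] in absolute value. *)
Definition leading_eigenvectors (R : realType) (d r : nat)
    (M : 'M[R]_d) (T : 'M[R]_(d, r)) : Prop :=
  T^T *m T = 1%:M /\
  exists (mu : 'rV[R]_r) (nu : 'rV[R]_(d - r)),
    [/\ char_poly M = (\prod_(i < r) ('X - (mu 0 i)%:P)) *
                      (\prod_(j < d - r) ('X - (nu 0 j)%:P)),
        forall i j, `|nu 0 j| <= `|mu 0 i| &
        forall i, M *m col i T = mu 0 i *: col i T].

(* [frakP T T' lam k] is $\mathfrak P^{-k}$: the index is the negated exponent,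
   and $\mathfrak P^0$ is the projector $\Theta_\perp\Theta_\perp^{\mathsf T}$. *)
Definition frakP (R : realType) (d r : nat) (T : 'M[R]_(d, r))
    (T' : 'M[R]_(d, d - r)) (lam : 'rV[R]_r) (k : nat) : 'M[R]_d :=
  if k is 0%N then T' *m T'^T
  else T *m diag_mx (\row_(j < r) lam 0 j ^- k) *m T^T.

Definition npos (n m : nat) (s : {ffun 'I_n -> 'I_m}) : nat :=
  #|[set j | (0 < s j)%N]|.

(* A tuple of [k+1] non-negative integers with sum [k] has entries at most [k],
   so it is a function to ['I_k.+1]; indices start at 0. *)
Definition pert_term (R : realType) (d r : nat) (T : 'M[R]_(d, r))
    (T' : 'M[R]_(d, d - r)) (lam : 'rV[R]_r) (X : 'M[R]_d) (k : nat) :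
    'M[R]_d :=
  \sum_(s : {ffun 'I_k.+1 -> 'I_k.+1} | (\sum_j s j)%N == k)
    (-1) ^+ (1 + npos s) *:
    (frakP T T' lam (s ord0) *m
     \big[mulmx/1%:M]_(j < k) (X *m frakP T T' lam (s (lift ord0 j)))).

(* Main.v *)
Require Import Defs.
From HB Require Import structures.
From mathcomp Require Import all_boot all_order all_algebra.
From mathcomp Require Import all_classical all_reals all_analysis.
From mathcomp Require Import ring lra zify.

(** Write H = A + X, x = ||X||, and fix rho with x < rho <= min |lambda_i| / 2.
    The textbook argument integrates the resolvent of H over the circle of
    radius rho and expands it in powers of X.  On that circle
    G(z) = z (z - A)^-1 has norm at most 1, which is exactly what makes the
    bound |lambda_i| / 2 sufficient, whereas counting the binomial(2k, k) terms
    of S_k and bounding each one only reaches |lambda_i| / 4.  The proof below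
    replaces the contour integral by manipulations of power series coefficients,
    so that everything stays over the reals.

    The expansion of G(z) at 0 is sum_m z^m G_m with G_0 = P^0 and
    G_m = - P^-m for m >= 1.  Let F_k(z) = G(z) (X G(z))^k, with coefficients
    F_(k, n); then S_k = - F_(k, k) ([pert_termE]).  The identity
    (z - A) F_(k+1)(z) = z X F_k(z) becomes a two-term recursion on
    coefficients.  The bound ||G|| <= 1 on the circle becomes a contraction for
    the square sums weighted by rho^(2 n) ([resolvent_contraction]); it yields
    |F_(k, n)| <= C x^k rho^(-n) ([coeff_entry_le]).

    The diagonal sums sum_k F_(k, k + m), for m an integer of either sign, are
    the Laurent coefficients of z (z - H)^-1 on the annulus x < |z| < rho.
    The middle one, E = sum_k F_(k, k), has the property that H^n E = O(x^n)
    while E - 1 = H^n W_n with W_n = O(rho^(-n)) ([resolvent_residue]).  Hence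
    (E - 1)^T E = W_n^T H^n E = O((x / rho)^n) vanishes, so that E is an
    orthogonal projector; in the same way it commutes with H.  It is the
    spectral projector of H for the eigenvalues of modulus below rho.

    It remains to see that the r given eigenvectors span the kernel of E.  Since
    the norms of H^n y form a log-convex sequence, the range of E meets the span
    of Theta trivially, and the kernel of E meets the span of Theta_perp
    trivially; so E has rank d - r.  Splitting the characteristic
    polynomial of H along E then shows that the r leading eigenvalues are
    exactly those of modulus at least rho ([leading_roots_not_small]), so E
    kills hTheta.  Consequently E = 1 - hTheta hTheta^T, and
    sum_(k >= 1) S_k = F_(0, 0) - E = (1 - Theta Theta^T) - E. *)

Set Implicit Arguments.
Unset Strict Implicit.
Unset Printing Implicit Defensive.

Import Order.TTheory GRing.Theory Num.Theory.
Import numFieldNormedType.Exports.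

Local Open Scope classical_set_scope.
Local Open Scope ring_scope.

(** * The Frobenius form and log-convexity of orbits *)

Section FrobeniusForm.
Variable R : realFieldType.

(** The Frobenius pairing of matrices of any shape.  Estimates are made on the
    squared norm [fsq], of vectors and of square matrices alike, which avoids
    square roots and Minkowski's inequality. *)
Definition fdot m n (M N : 'M[R]_(m, n)) : R := \sum_i \sum_j M i j * N i j.
Definition fsq m n (M : 'M[R]_(m, n)) : R := fdot M M.

Lemma fdotE m n (M N : 'M[R]_(m, n)) : fdot M N = \tr (M^T *m N).
Proof.
rewrite /mxtrace /fdot exchange_big; apply: eq_bigr => j _.
by rewrite mxE; apply: eq_bigr => i _; rewrite mxE.
Qed.

Lemma fdotC m n (M N : 'M[R]_(m, n)) : fdot M N = fdot N M.
Proof. by apply: eq_bigr => i _; apply: eq_bigr => j _; rewrite mulrC. Qed.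

Lemma fdotDr m n (M N P : 'M[R]_(m, n)) : fdot M (N + P) = fdot M N + fdot M P.
Proof. by rewrite !fdotE mulmxDr raddfD. Qed.

Lemma fdotZr m n a (M N : 'M[R]_(m, n)) : fdot M (a *: N) = a * fdot M N.
Proof. by rewrite !fdotE -scalemxAr linearZ. Qed.

Lemma fdot_adj m n p (M : 'M[R]_(m, n)) (A : 'M[R]_(m, p)) (N : 'M[R]_(p, n)) :
  fdot M (A *m N) = fdot (A^T *m M) N.
Proof. by rewrite !fdotE trmx_mul trmxK mulmxA. Qed.

Lemma fsqE m n (M : 'M[R]_(m, n)) : fsq M = \sum_i \sum_j M i j ^+ 2.
Proof. by apply: eq_bigr => i _; apply: eq_bigr => j _; rewrite expr2. Qed.

Lemma fsq_ge0 m n (M : 'M[R]_(m, n)) : 0 <= fsq M.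
Proof. by rewrite fsqE; do 2 apply: sumr_ge0 => ? _; apply: sqr_ge0. Qed.

Lemma fsq0 m n : fsq (0 : 'M[R]_(m, n)) = 0.
Proof. by rewrite /fsq fdotE mulmx0 raddf0. Qed.

Lemma fsq1 n : fsq (1%:M : 'M[R]_n) = n%:R.
Proof. by rewrite /fsq fdotE trmx1 mulmx1 mxtrace1. Qed.

Lemma sqr_entry_le_fsq m n (M : 'M[R]_(m, n)) i j : M i j ^+ 2 <= fsq M.
Proof.
rewrite fsqE (bigD1 i) //= (bigD1 j) //= -addrA lerDl.
by apply: addr_ge0; [|apply: sumr_ge0 => ? _];
  apply: sumr_ge0 => ? _; apply: sqr_ge0.
Qed.

Lemma fsq_eq0 m n (M : 'M[R]_(m, n)) : fsq M <= 0 -> M = 0.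
Proof.
move=> M0; apply/matrixP => i j; rewrite mxE; apply/eqP.
by rewrite -sqrf_eq0 eq_le sqr_ge0 (le_trans (sqr_entry_le_fsq M i j)).
Qed.

Lemma fsqN m n (M : 'M[R]_(m, n)) : fsq (- M) = fsq M.
Proof. by rewrite !fsqE; do 2 apply: eq_bigr => ? _; rewrite mxE sqrrN. Qed.

Lemma fsqZ m n a (M : 'M[R]_(m, n)) : fsq (a *: M) = a ^+ 2 * fsq M.
Proof. by rewrite /fsq fdotZr fdotC fdotZr mulrA. Qed.

Lemma fsqD m n (M N : 'M[R]_(m, n)) :
  fsq (M + N) = fsq M + fdot M N *+ 2 + fsq N.
Proof.
rewrite /fsq fdotDr ![fdot (M + N) _]fdotC !fdotDr [fdot N M]fdotC mulr2n.
by rewrite !addrA.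
Qed.

Lemma fsqB_le m n (M N : 'M[R]_(m, n)) : fsq (M - N) <= 2 * fsq M + 2 * fsq N.
Proof.
have : 0 <= fsq (M + N) by apply: fsq_ge0.
have -> : fsq (M - N) = fsq M - fdot M N *+ 2 + fsq N.
  by rewrite fsqD fsqN -scaleN1r fdotZr mulN1r mulNrn.
by rewrite fsqD mulr2n; lra.
Qed.

Lemma fsq_isometry m n p (T : 'M[R]_(m, n)) (M : 'M[R]_(n, p)) :
  T^T *m T = 1%:M -> fsq (T *m M) = fsq M.
Proof. by move=> TT; rewrite /fsq fdot_adj mulmxA TT mul1mx. Qed.

Lemma fdot_CS m n (M N : 'M[R]_(m, n)) : fdot M N ^+ 2 <= fsq M * fsq N.
Proof.
have [N0|N_neq0] := leP (fsq N) 0.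
  by rewrite (fsq_eq0 N0) fsq0 mulr0 fdotE mulmx0 raddf0 expr0n.
have := fsq_ge0 (fsq N *: M - fdot M N *: N).
rewrite fsqD fsqN !fsqZ -scaleNr fdotZr [fdot (_ *: _) _]fdotC fdotZr.
rewrite [fdot N M]fdotC => h.
rewrite -subr_ge0 -(pmulr_rge0 _ N_neq0); apply: le_trans h _.
rewrite le_eqVlt; apply/orP; left; apply/eqP; ring.
Qed.

Lemma fsq_le_entries m n (M : 'M[R]_(m, n)) a :
  (forall i j, `|M i j| <= a) -> fsq M <= (m * n)%:R * a ^+ 2.
Proof.
move=> Ma; rewrite fsqE.
have Ma2 i j : M i j ^+ 2 <= a ^+ 2.
  rewrite -[M i j ^+ 2]real_normK ?num_real // lerXn2r ?nnegrE //.
  exact: le_trans (Ma i j).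
apply: (@le_trans _ _ (\sum_(i < m) \sum_(j < n) a ^+ 2)).
  by do 2 apply: ler_sum => ? _.
by rewrite !(sumr_const, card_ord) -mulrnA mulr_natl mulnC.
Qed.

Lemma fsq_tr m n (M : 'M[R]_(m, n)) : fsq M^T = fsq M.
Proof.
rewrite !fsqE exchange_big; do 2 apply: eq_bigr => ? _.
by rewrite mxE.
Qed.

End FrobeniusForm.

Section LogConvexity.
Variables (R : realFieldType) (d p : nat) (H : 'M[R]_d).
Hypothesis symH : H^T = H.

(** Cauchy-Schwarz applied to the pairing of y with H^2 y, which is |H y|^2 as H
    is symmetric. *)
Lemma fsq_log_convex (y : 'M[R]_(d, p)) :
  fsq (H *m y) ^+ 2 <= fsq y * fsq (H *m (H *m y)).
Proof. by rewrite {1}/fsq fdot_adj symH fdotC; apply: fdot_CS. Qed.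

(** In a log-convex sequence the ratios of consecutive terms do not decrease: a
    growth rate at the start of an orbit persists, and, for [fsq_iter_le], a
    bound on the last ratio bounds all the earlier ones. *)
Lemma fsq_iter_ge (c : R) n (y : 'M[R]_(d, p)) : 0 <= c ->
  c * fsq y <= fsq (H *m y) -> c ^+ n * fsq y <= fsq (iter n (mulmx H) y).
Proof.
move=> c0; elim: n y => [|n IHn] y cy; first by rewrite mul1r.
rewrite iterSr; apply: le_trans (IHn (H *m y) _).
  by rewrite exprSr -mulrA ler_wpM2l // exprn_ge0.
have [b0|b_gt0] := leP (fsq (H *m y)) 0.
  by rewrite (le_trans _ (fsq_ge0 _)) // mulr_ge0_le0.
rewrite -(ler_pM2r b_gt0) -mulrA -expr2.
apply: le_trans (ler_wpM2l c0 (fsq_log_convex y)) _.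
by rewrite mulrA [X in _ <= X]mulrC ler_wpM2r // fsq_ge0.
Qed.

Lemma fsq_iter_le (c : R) n (y : 'M[R]_(d, p)) : 0 <= c ->
  fsq (iter n.+1 (mulmx H) y) <= c * fsq (iter n (mulmx H) y) ->
  fsq (iter n (mulmx H) y) <= c ^+ n * fsq y.
Proof.
move=> c0; elim: n => [|n IHn] /=; first by rewrite mul1r.
set z := iter n _ y in IHn * => cz.
have bz : fsq (H *m z) <= c * fsq z.
  have [b0|b_gt0] := leP (fsq (H *m z)) 0.
    by rewrite (le_trans b0) // mulr_ge0 // fsq_ge0.
  rewrite -(ler_pM2r b_gt0) -expr2 (le_trans (fsq_log_convex z)) //.
  by rewrite [c * _]mulrC -mulrA ler_wpM2l // fsq_ge0.
by rewrite (le_trans bz) // exprS -mulrA ler_wpM2l // IHn.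
Qed.

End LogConvexity.

(** * The operator norm *)

Section OperatorNorm.
Variable R : realType.

Lemma l2normE n (v : 'cV[R]_n) : l2norm v = Num.sqrt (fsq v).
Proof.
by congr Num.sqrt; rewrite fsqE; apply: eq_bigr => i _; rewrite big_ord1.
Qed.

Lemma fsq_sum_col m n (M : 'M[R]_(m, n)) : fsq M = \sum_j fsq (col j M).
Proof.
rewrite fsqE exchange_big; apply: eq_bigr => j _; rewrite fsqE.
by apply: eq_bigr => i _; rewrite big_ord1 mxE.
Qed.

Lemma fsqM_le m n p (M : 'M[R]_(m, n)) (N : 'M[R]_(n, p)) :
  fsq (M *m N) <= fsq M * fsq N.
Proof.
rewrite [fsq (M *m N)]fsqE [fsq M]fsqE mulr_suml; apply: ler_sum => i _.
rewrite (fsq_sum_col N) mulr_sumr; apply: ler_sum => j _.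
have -> : (M *m N) i j = fdot (row i M)^T (col j N).
  by rewrite mxE; apply: eq_bigr => k _; rewrite big_ord1 !mxE.
apply: le_trans (fdot_CS _ _) _; rewrite ler_wpM2r ?fsq_ge0 //.
by rewrite fsqE; apply: ler_sum => k _; rewrite big_ord1 !mxE.
Qed.

Lemma l2normM_le m n (M : 'M[R]_(m, n)) (v : 'cV[R]_n) :
  l2norm (M *m v) <= opnorm M * l2norm v.
Proof.
pose S := [set l2norm (M *m v) | v in [set v : 'cV[R]_n | l2norm v <= 1]].
have ubS : has_ubound S.
  exists (Num.sqrt (fsq M)) => _ [w w1 <-]; rewrite l2normE ler_wsqrtr //.
  apply: le_trans (fsqM_le M w) _; rewrite -[leRHS]mulr1 ler_wpM2l ?fsq_ge0 //.
  have : l2norm w ^+ 2 <= 1 by rewrite expr_le1 // l2normE sqrtr_ge0.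
  by rewrite l2normE sqr_sqrtr // fsq_ge0.
have [v0|v_gt0] := leP (l2norm v) 0.
  have /fsq_eq0 -> : fsq v <= 0.
    rewrite -(sqr_sqrtr (fsq_ge0 v)) -l2normE.
    by have /eqP -> : l2norm v == 0; rewrite ?expr0n // eq_le v0 l2normE sqrtr_ge0.
  by rewrite mulmx0 !l2normE !fsq0 sqrtr0 mulr0.
have normZ a k (w : 'cV[R]_k) : 0 <= a -> l2norm (a *: w) = a * l2norm w.
  by move=> a0; rewrite !l2normE fsqZ sqrtrM ?sqr_ge0 // sqrtr_sqr ger0_norm.
rewrite -ler_pdivrMr // mulrC -normZ ?invr_ge0 ?(ltW v_gt0) // scalemxAr.
apply: ub_le_sup => //; exists ((l2norm v)^-1 *: v) => //=.
by rewrite normZ ?invr_ge0 ?(ltW v_gt0) // mulVf // gt_eqF.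
Qed.

Lemma opnorm_ge0 m n (M : 'M[R]_(m, n)) : 0 <= opnorm M.
Proof.
rewrite /opnorm; set S := (X in sup X).
have [ubS|] := pselect (has_sup S); last by move=> /sup_out ->.
apply: le_trans (ub_le_sup _ (_ : S 0)); [by []|by case: ubS|].
by exists 0; rewrite /= ?mulmx0 l2normE fsq0 sqrtr0 ?ler01.
Qed.

Lemma fsqM_opnorm m n p (M : 'M[R]_(m, n)) (N : 'M[R]_(n, p)) :
  fsq (M *m N) <= opnorm M ^+ 2 * fsq N.
Proof.
rewrite !(fsq_sum_col (_ *m _)) (fsq_sum_col N) mulr_sumr.
apply: ler_sum => j _; rewrite colE -mulmxA -colE.
have l0 k (w : 'cV[R]_k) : 0 <= l2norm w by rewrite l2normE sqrtr_ge0.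
have : l2norm (M *m col j N) ^+ 2 <= (opnorm M * l2norm (col j N)) ^+ 2.
  by rewrite ler_pXn2r ?nnegrE ?mulr_ge0 ?opnorm_ge0 ?l2normM_le.
by rewrite exprMn !l2normE !sqr_sqrtr ?fsq_ge0.
Qed.

End OperatorNorm.

(** * Entrywise limits and geometric domination *)

Section EntrywiseLimits.
Variable R : realType.

(** Limits are taken entry by entry, so that the theorems on real series apply
    directly; [mx_cvg_topology] goes back to the norm topology. *)
Definition mx_cvg m n (u : nat -> 'M[R]_(m, n)) (L : 'M[R]_(m, n)) : Prop :=
  forall i j, (fun k => u k i j) @ \oo --> L i j.

Lemma mx_cvg_unique m n (u : nat -> 'M[R]_(m, n)) L L' :
  mx_cvg u L -> mx_cvg u L' -> L = L'.
Proof.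
move=> uL uL'; apply/matrixP => i j.
exact: (cvg_unique _ (uL i j) (uL' i j)).
Qed.

Lemma mx_cvg_cst m n (M : 'M[R]_(m, n)) : mx_cvg (fun=> M) M.
Proof. by move=> i j; apply: cvg_cst. Qed.

Lemma mx_cvgD m n (u v : nat -> 'M[R]_(m, n)) L M :
  mx_cvg u L -> mx_cvg v M -> mx_cvg (fun k => u k + v k) (L + M).
Proof.
move=> uL vM i j; rewrite mxE; under eq_fun do rewrite mxE.
exact: cvgD.
Qed.

Lemma mx_cvgM m n p (A : 'M[R]_(m, n)) (u : nat -> 'M[R]_(n, p)) L :
  mx_cvg u L -> mx_cvg (fun k => A *m u k) (A *m L).
Proof.
move=> uL i j; rewrite mxE; under eq_fun do rewrite mxE.
apply: cvg_big => [|k _]; last exact: cvgMl_tmp.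
exact: add_continuous.
Qed.

Lemma mx_cvg_shift m n (u : nat -> 'M[R]_(m, n)) L :
  mx_cvg u L <-> mx_cvg (fun k => u k.+1) L.
Proof.
by split=> uL i j; [rewrite (cvg_shiftS (fun k => u k i j))|
  rewrite -(cvg_shiftS (fun k => u k i j))]; apply: uL.
Qed.

Lemma mx_cvg_term m n (u : nat -> 'M[R]_(m, n)) L :
  mx_cvg (fun N => \sum_(k < N) u k) L -> mx_cvg u 0.
Proof.
move=> uL; have -> : 0 = L + (- 1%:M) *m L by rewrite mulNmx mul1mx subrr.
have -> : u = fun N => \sum_(k < N.+1) u k + (- 1%:M) *m \sum_(k < N) u k.
  apply/funext => N; rewrite big_ord_recr mulNmx mul1mx /=.
  by rewrite addrAC subrr add0r.
apply: mx_cvgD; last exact: mx_cvgM.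
by move/mx_cvg_shift: uL.
Qed.

Lemma mx_cvg_topology m n (u : nat -> 'M[R]_(m, n)) L :
  mx_cvg u L -> u @ \oo --> L.
Proof.
move=> uL; apply/cvgrPdist_le => e e0.
have near_uL : \forall k \near \oo, forall ij : 'I_m * 'I_n,
    `|L ij.1 ij.2 - u k ij.1 ij.2| <= e.
  apply: filter_forall => -[i j] /=.
  by move/cvgrPdist_le: (uL i j) => /(_ e e0).
apply: filterS near_uL => k uk.
rewrite [leLHS]/Num.Def.normr /= mx_normrE.
by apply/bigmax_leP; split=> [|ij _]; [exact: ltW|rewrite !mxE].
Qed.

Lemma sum_geometric_le (q : R) N : 0 <= q < 1 ->
  \sum_(k < N) q ^+ k <= (1 - q)^-1.
Proof.
move=> /andP[q0 q1]; rewrite -[leRHS]mul1r ler_pdivlMr ?subr_gt0 //.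
suff -> : (\sum_(k < N) q ^+ k) * (1 - q) = 1 - q ^+ N.
  by rewrite gerBl exprn_ge0.
by rewrite mulrC -opprB mulNr -subrX1 opprB.
Qed.

Lemma cvg_geometric_dominated (a : nat -> R) c q :
    0 <= q < 1 -> (forall k, `|a k| <= c * q ^+ k) ->
  exists2 l, (fun N => \sum_(k < N) a k) @ \oo --> l & `|l| <= c / (1 - q).
Proof.
move=> q01 a_le; have /andP[q0 q1] := q01.
have c0 : 0 <= c by rewrite -[c]mulr1; apply: le_trans (a_le 0%N).
have sumE : (fun N => \sum_(k < N) a k) = series a.
  by apply/funext => N; rewrite /series /= big_mkord.
have cvga : cvgn (series a).
  apply: normed_cvg; apply: (@series_le_cvg _ _ (geometric c q)) => //=.
  - by move=> k; rewrite mulr_ge0 ?exprn_ge0.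
  - by apply: is_cvg_geometric_series; rewrite ger0_norm.
exists (limn (series a)).
  have : series a @ \oo --> limn (series a) by [].
  by rewrite -{1}sumE.
have cvgn_norm : (fun N => `|series a N|) @ \oo --> `|limn (series a)|.
  exact: cvg_norm.
rewrite -(cvg_lim _ cvgn_norm) //; apply: limr_le; first exact: cvgP cvgn_norm.
apply: nearW => N; rewrite -sumE; apply: le_trans (ler_norm_sum _ _ _) _.
apply: (@le_trans _ _ (\sum_(k < N) c * q ^+ k)); first exact: ler_sum.
by rewrite -mulr_sumr ler_wpM2l // sum_geometric_le.
Qed.

Lemma mx_cvg_geometric_dominated m n (u : nat -> 'M[R]_(m, n)) c q :
    0 <= q < 1 -> (forall k i j, `|u k i j| <= c * q ^+ k) ->
  exists2 L, mx_cvg (fun N => \sum_(k < N) u k) L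
           & forall i j, `|L i j| <= c / (1 - q).
Proof.
move=> q01 u_le.
have /(_ _ _)/cid2 l i j :=
  cvg_geometric_dominated q01 (fun k => u_le k i j).
exists (\matrix_(i, j) s2val (l i j)) => i j; rewrite mxE; case: (l i j) => //=.
by move=> y; under [X in X @ _ --> _ -> _]eq_fun do rewrite -summxE.
Qed.

Lemma geometric_bounded_eq0 (a c q : R) :
  0 <= q < 1 -> (forall n, `|a| <= c * q ^+ n) -> a = 0.
Proof.
move=> /andP[q0 q1] a_le; apply/eqP; rewrite -normr_eq0 eq_le normr_ge0 andbT.
have geo : geometric c q @ \oo --> 0 by apply: cvg_geometric; rewrite ger0_norm.
rewrite -(cvg_lim _ geo) //; apply: limr_ge; first exact: cvgP geo.
exact: nearW.
Qed.

(** This is how all the vanishing statements about the residue are obtained: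
    the same quantity is bounded by two geometric sequences of different rates. *)
Lemma geometric_le_eq0 (a C s t : R) : 0 <= a -> 0 <= s < t ->
  (forall n, t ^+ (2 * n) * a <= C * s ^+ (2 * n)) -> a = 0.
Proof.
move=> a0 /andP[s0 st] a_le; have t0 : 0 < t by apply: le_lt_trans st.
apply: (@geometric_bounded_eq0 _ C ((s / t) ^+ 2)).
  rewrite sqr_ge0 expr_lt1 //; first by rewrite ltr_pdivrMr // mul1r.
  by rewrite divr_ge0 // ltW.
move=> n; rewrite ger0_norm // -exprM expr_div_n mulrA.
by rewrite ler_pdivlMr ?exprn_gt0 // mulrC.
Qed.

End EntrywiseLimits.

(** * Coefficients of the resolvent on a circle *)

Section Contraction.
Variables (R : realType) (d : nat) (A X P : 'M[R]_d) (rho : R).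
Hypotheses (symP : P^T = P) (idP : P *m P = P) (PA : P *m A = A).
Hypothesis rho_gt0 : 0 < rho.
Hypothesis A_expand :
  forall p (v : 'M[R]_(d, p)), 4 * rho ^+ 2 * fsq (P *m v) <= fsq (A *m v).

Lemma fsq_pythagoras p (v : 'M[R]_(d, p)) :
  fsq v = fsq (P *m v) + fsq (v - P *m v).
Proof.
have -> : fsq v = fsq (P *m v + (v - P *m v)) by rewrite addrC subrK.
rewrite fsqD fdotC fdot_adj symP mulmxBr mulmxA idP subrr fdotE trmx0 mul0mx.
by rewrite raddf0 mul0rn addr0.
Qed.

(** The hypotheses say that w(z) = z (z - A)^-1 u(z) as power series without
    polar part, and the conclusion that z (z - A)^-1 is a contraction for the
    Hardy norm on the circle |z| = rho.  On the kernel of P the sequences u and w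
    agree.  On its range, A w_(n+1) = w_n - u_n gives
    4 rho^2 |w_(n+1)|^2 <= 2 |w_n|^2 + 2 |u_n|^2; summing up with weights, half of
    the left-hand side absorbs the terms in w. *)
Lemma resolvent_contraction p (u w : nat -> 'M[R]_(d, p)) N :
    A *m w 0%N = 0 -> (forall n, w n - A *m w n.+1 = u n) ->
  \sum_(n < N) rho ^+ (2 * n) * fsq (w n)
    <= \sum_(n < N) rho ^+ (2 * n) * fsq (u n).
Proof.
move=> w0 wS; have rho0 := ltW rho_gt0.
have sumP : \sum_(n < N) rho ^+ (2 * n) * fsq (P *m w n)
    + 2 * rho ^+ (2 * N) * fsq (P *m w N)
    <= \sum_(n < N) rho ^+ (2 * n) * fsq (P *m u n).
  elim: N => [|N IHN].
    rewrite !big_ord0 add0r mulr1.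
    have := A_expand (w 0%N); rewrite w0 fsq0.
    by rewrite !pmulr_rle0 // ?mulr_gt0 // exprn_gt0.
  rewrite !big_ord_recr /= mulnS exprD.
  have step : 4 * rho ^+ 2 * fsq (P *m w N.+1)
      <= 2 * fsq (P *m w N) + 2 * fsq (P *m u N).
    apply: le_trans (A_expand _) (le_trans _ (fsqB_le _ _)).
    rewrite -mulmxBr -wS opprB addrC subrK.
    by rewrite mulmxA PA.
  have rN : 0 <= rho ^+ (2 * N) by rewrite exprn_ge0.
  by have := ler_wpM2l rN step; lra.
have PwP : \sum_(n < N) rho ^+ (2 * n) * fsq (P *m w n)
    <= \sum_(n < N) rho ^+ (2 * n) * fsq (P *m u n).
  apply: le_trans sumP; rewrite lerDl.
  by rewrite !mulr_ge0 ?fsq_ge0 // exprn_ge0.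
under eq_bigr do rewrite fsq_pythagoras mulrDr.
under [leRHS]eq_bigr do rewrite fsq_pythagoras mulrDr.
rewrite !big_split lerD //= le_eqVlt; apply/orP; left; apply/eqP.
apply: eq_bigr => n _; rewrite -wS mulmxBr mulmxA PA.
by rewrite opprB addrA subrK.
Qed.

Variable F : nat -> nat -> 'M[R]_d.
Hypothesis AF0 : forall k, A *m F k 0 = 0.
Hypothesis F0S : forall n, F 0 n - A *m F 0 n.+1 = (n == 0)%:R%:M.
Hypothesis FSS : forall k n, F k.+1 n - A *m F k.+1 n.+1 = X *m F k n.

(** Passing from k to k+1 multiplies by X, of norm x, and then applies the
    contraction.  The case k = 0 starts from the constant series 1. *)
Lemma weighted_sum_le k N :
  \sum_(n < N) rho ^+ (2 * n) * fsq (F k n) <= opnorm X ^+ (2 * k) * d%:R.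
Proof.
elim: k => [|k IHk].
  apply: le_trans (resolvent_contraction N (AF0 0) F0S) _.
  rewrite mul1r; case: N => [|N]; first by rewrite big_ord0.
  rewrite big_ord_recl mul1r fsq1 big1 ?addr0 // => i _.
  by rewrite /= mulr0n raddf0 fsq0 mulr0.
apply: le_trans (resolvent_contraction N (AF0 k.+1) (FSS k)) _.
rewrite mulnS exprD -mulrA.
apply: le_trans (ler_wpM2l (sqr_ge0 _) IHk); rewrite mulr_sumr.
apply: ler_sum => n _; rewrite mulrCA ler_wpM2l ?fsqM_opnorm //.
by rewrite exprn_ge0 // ltW.
Qed.

Lemma coeff_entry_le k n i j :
  `|F k n i j| <= (d%:R + 1) * opnorm X ^+ k * rho ^- n.
Proof.
have rn : 0 < rho ^+ n by rewrite exprn_gt0.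
have xk : 0 <= opnorm X ^+ k by rewrite exprn_ge0 ?opnorm_ge0.
have d0 : 0 <= d%:R :> R by rewrite ler0n.
have d1 : 0 <= d%:R + 1 :> R by rewrite addr_ge0.
rewrite ler_pdivlMr // -(@ler_pXn2r _ 2) ?nnegrE ?mulr_ge0 ?(ltW rn) //.
rewrite !exprMn real_normK ?num_real //.
have -> : rho ^+ n ^+ 2 = rho ^+ (2 * n) by rewrite mulnC exprM.
have -> : opnorm X ^+ k ^+ 2 = opnorm X ^+ (2 * k) by rewrite mulnC exprM.
have rn2 : 0 <= rho ^+ (2 * n) by rewrite exprn_ge0 // ltW.
have xk2 : 0 <= opnorm X ^+ (2 * k) by rewrite exprn_ge0 ?opnorm_ge0.
apply: le_trans (ler_wpM2r rn2 (sqr_entry_le_fsq (F k n) i j)) _.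
rewrite mulrC; apply: (@le_trans _ _ (opnorm X ^+ (2 * k) * d%:R)); last first.
  by rewrite mulrC ler_wpM2r //; nra.
apply: le_trans (weighted_sum_le k n.+1); rewrite big_ord_recr lerDr /=.
by apply: sumr_ge0 => m _; rewrite mulr_ge0 ?fsq_ge0 ?exprn_ge0 // ltW.
Qed.

End Contraction.

(** * Laurent coefficients of the perturbed resolvent *)

Section ResolventLaurent.
Variables (R : realType) (d : nat) (A X : 'M[R]_d) (F : nat -> nat -> 'M[R]_d).
Variables (K x rho : R).
Hypothesis AF0 : forall k, A *m F k 0 = 0.
Hypothesis F0S : forall n, F 0 n - A *m F 0 n.+1 = (n == 0)%:R%:M.
Hypothesis FSS : forall k n, F k.+1 n - A *m F k.+1 n.+1 = X *m F k n.
Hypothesis x_rho : 0 <= x < rho.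
Hypothesis F_le : forall k n i j, `|F k n i j| <= K * x ^+ k * rho ^- n.

Let H := A + X.
Let q := x / rho.

Let rho_gt0 : 0 < rho.
Proof. by case/andP: x_rho => x0; apply: le_lt_trans. Qed.

Let q01 : 0 <= q < 1.
Proof.
case/andP: x_rho => x0 xr.
by rewrite divr_ge0 ?(ltW rho_gt0) //= ltr_pdivrMr ?mul1r.
Qed.

(** The two-term recursion makes the sums along a diagonal of F telescope under
    A + X, which moves them to the neighbouring diagonal: this is the Laurent
    form of (z - H) (z - H)^-1 = 1.  The error term involves a single coefficient
    and tends to 0. *)
Lemma mulmx_sum_subdiag m N :
  H *m (\sum_(k < N.+1) F (k + m) k)
    = \sum_(k < N) F (k + m.+1) k + X *m F (N + m) N.
Proof.
elim: N => [|N IHN]; first by rewrite big_ord1 big_ord0 mulmxDl AF0 !add0r.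
rewrite big_ord_recr mulmxDr {}IHN /= [in RHS]big_ord_recr /= -!addrA.
congr (_ + _); rewrite mulmxDl addrA; congr (_ + _).
by rewrite -FSS addSn addnS subrK.
Qed.

Lemma mulmx_sum_superdiag m N :
  H *m (\sum_(k < N.+1) F k (k + m.+1))
    = \sum_(k < N.+1) F k (k + m) - (m == 0)%:R%:M + X *m F N (N + m.+1).
Proof.
elim: N => [|N IHN].
  by rewrite !big_ord1 mulmxDl !add0n -F0S opprB [F 0 m + _]addrC subrK.
rewrite big_ord_recr mulmxDr {}IHN /= [in RHS]big_ord_recr /=.
rewrite mulmxDl addrA -[X in X + _ = _]addrA -FSS !addnS !addSn subrK.
by rewrite [X in X + _ = _]addrAC.
Qed.

Lemma subdiag_cvg m : exists2 L,
    mx_cvg (fun N => \sum_(k < N) F (k + m) k) L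
  & forall i j, `|L i j| <= K / (1 - q) * x ^+ m.
Proof.
have [|L cvgL L_le] := @mx_cvg_geometric_dominated R d d
  (fun k => F (k + m) k) (K * x ^+ m) q q01.
  move=> k i j; apply: le_trans (F_le _ _ _ _) _.
  by rewrite exprD expr_div_n [x ^+ k * _]mulrC !mulrA.
by exists L => // i j; rewrite mulrAC; apply: L_le.
Qed.

Lemma superdiag_cvg m : exists2 L,
    mx_cvg (fun N => \sum_(k < N) F k (k + m)) L
  & forall i j, `|L i j| <= K / (1 - q) * rho ^- m.
Proof.
have [|L cvgL L_le] := @mx_cvg_geometric_dominated R d d
  (fun k => F k (k + m)) (K * rho ^- m) q q01.
  move=> k i j; apply: le_trans (F_le _ _ _ _) _.
  by rewrite exprD expr_div_n invfM -!mulrA [rho ^- m * _]mulrC !mulrA.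
by exists L => // i j; rewrite mulrAC; apply: L_le.
Qed.

(** E is the residue at 0 of the perturbed resolvent, seen from the annulus
    x < |z| < rho: the coefficients H^n E of negative index decay like x^n and the
    coefficients W of positive index like rho^(-n). *)
Lemma resolvent_residue : exists2 E,
    mx_cvg (fun N => \sum_(k < N) F k k) E &
    exists K', (forall n i j, `|iter n (mulmx H) E i j| <= K' * x ^+ n) /\
      (forall n, exists2 W, E - 1%:M = iter n (mulmx H) W
                          & forall i j, `|W i j| <= K' * rho ^- n).
Proof.
have /(_ _)/cid2 V := subdiag_cvg; have /(_ _)/cid2 W := superdiag_cvg.
pose v m := s2val (V m); pose w m := s2val (W m).
have vP m : mx_cvg (fun N => \sum_(k < N) F (k + m) k) (v m) := s2valP (V m).
have wP m : mx_cvg (fun N => \sum_(k < N) F k (k + m)) (w m) := s2valP (W m).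
have v_le m i j : `|v m i j| <= K / (1 - q) * x ^+ m by apply: (s2valP' (V m)).
have w_le m i j : `|w m i j| <= K / (1 - q) * rho ^- m.
  exact: (s2valP' (W m)).
have Xcvg0 (u : nat -> 'M[R]_d) : mx_cvg u 0 -> mx_cvg (fun k => X *m u k) 0.
  by move=> u0; rewrite -(mulmx0 _ X); apply: mx_cvgM.
have vS m : H *m v m = v m.+1.
  have /mx_cvg_shift := mx_cvgM (A := H) (vP m).
  under eq_fun do rewrite mulmx_sum_subdiag.
  move/mx_cvg_unique; apply; rewrite -[v m.+1]addr0.
  by apply: mx_cvgD (vP m.+1) _; apply: Xcvg0; apply: mx_cvg_term (vP m).
have wS m : H *m w m.+1 = w m - (m == 0)%:R%:M.
  have /mx_cvg_shift := mx_cvgM (A := H) (wP m.+1).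
  under eq_fun do rewrite mulmx_sum_superdiag.
  move/mx_cvg_unique; apply; rewrite -[w m - _]addr0.
  apply: mx_cvgD; last by apply: Xcvg0; apply: mx_cvg_term (wP m.+1).
  apply: mx_cvgD _ (@mx_cvg_cst _ _ _ _).
  by have /mx_cvg_shift := wP m.
have vP0 : mx_cvg (fun N => \sum_(k < N) F k k) (v 0).
  by have := vP 0; under eq_fun do under eq_bigr do rewrite addn0.
have w0 : w 0 = v 0.
  apply: mx_cvg_unique vP0; have := wP 0.
  by under eq_fun do under eq_bigr do rewrite addn0.
have vE n : iter n (mulmx H) (v 0) = v n.
  by elim: n => //= n ->; apply: vS.
have wE n : v 0 - 1%:M = iter n.+1 (mulmx H) (w n.+1).
  elim: n => [|n IHn]; first by rewrite /= wS w0.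
  by rewrite iterSr wS /= mulr0n raddf0 subr0 IHn.
exists (v 0) => //.
exists (K / (1 - q) + 1); have K1 : K / (1 - q) <= K / (1 - q) + 1 by rewrite lerDl.
have x0 : 0 <= x by case/andP: x_rho.
split=> [n i j|[|n]].
- by rewrite vE (le_trans (v_le _ _ _)) // ler_wpM2r // exprn_ge0.
- exists (v 0 - 1%:M) => // i j; rewrite !mxE invr1 mulr1.
  apply: le_trans (ler_normB _ _) _; apply: lerD.
    by rewrite -[leRHS]mulr1; apply: v_le.
  by case: (i == j); rewrite ?normr1 ?normr0.
exists (w n.+1) => // i j; apply: le_trans (w_le _ _ _) _.
by rewrite ler_wpM2r // invr_ge0 exprn_ge0 // ltW.
Qed.

End ResolventLaurent.

(** * The residue is a spectral projector *)

Section GeometricProjector.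
Variables (R : realType) (d : nat) (H E : 'M[R]_d) (K x rho : R).
Hypothesis symH : H^T = H.
Hypothesis x_rho : 0 <= x < rho.
Hypothesis HE_le :
  forall n i j, `|iter n (mulmx H) E i j| <= K * x ^+ n.
Hypothesis EI_range : forall n,
  exists2 W, E - 1%:M = iter n (mulmx H) W
           & forall i j, `|W i j| <= K * rho ^- n.

Let x_ge0 : 0 <= x. Proof. by case/andP: x_rho. Qed.
Let rho_gt0 : 0 < rho.
Proof. by case/andP: x_rho => x0; apply: le_lt_trans. Qed.

Lemma tr_iter_mulmx m p n (M : 'M[R]_(d, m)) (N : 'M[R]_(d, p)) :
  (iter n (mulmx H) M)^T *m N = M^T *m iter n (mulmx H) N.
Proof.
by elim: n N => //= n IHn N; rewrite trmx_mul symH -mulmxA IHn -iterSr.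
Qed.

Lemma iter_mulmxA m p n (M : 'M[R]_(d, m)) (N : 'M[R]_(m, p)) :
  iter n (mulmx H) M *m N = iter n (mulmx H) (M *m N).
Proof. by elim: n => //= n IHn; rewrite -mulmxA IHn. Qed.

Lemma iter_mulmx_eigen p n mu (v : 'M[R]_(d, p)) :
  H *m v = mu *: v -> iter n (mulmx H) v = mu ^+ n *: v.
Proof.
move=> Hv; elim: n => [|n IHn] /=; first by rewrite scale1r.
by rewrite IHn -scalemxAr Hv scalerA -exprSr.
Qed.

Lemma fsq_HE_le n :
  fsq (iter n (mulmx H) E) <= (d * d)%:R * K ^+ 2 * x ^+ (2 * n).
Proof.
apply: le_trans (fsq_le_entries (HE_le n)) _.
by rewrite exprMn -exprM [(n * 2)%N]mulnC mulrA.
Qed.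

Lemma EI_rangeP n : exists2 W, E - 1%:M = iter n (mulmx H) W &
  rho ^+ (2 * n) * fsq W <= (d * d)%:R * K ^+ 2.
Proof.
have [W EW W_le] := EI_range n; exists W => //.
apply: le_trans (ler_wpM2l _ (fsq_le_entries W_le)) _.
  by rewrite exprn_ge0 // ltW.
rewrite exprMn exprVn -exprM [(n * 2)%N]mulnC mulrC mulrA.
by rewrite mulfVK // gt_eqF // exprn_gt0.
Qed.

(** By symmetry of H the product equals W_n^T H^(n+m) E for every n, and this is
    O((x / rho)^n).  The case m = 0 makes E an orthogonal projector, and m = 1
    makes its range stable under H. *)
Lemma residue_orth m : (E - 1%:M)^T *m iter m (mulmx H) E = 0.
Proof.
apply/fsq_eq0; rewrite le_eqVlt; apply/orP; left; apply/eqP.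
set C := (d * d)%:R * K ^+ 2.
apply: (@geometric_le_eq0 _ _ (C * C * x ^+ (2 * m)) x rho) => [||n] //.
  exact: fsq_ge0.
have [W -> W_le] := EI_rangeP n; rewrite tr_iter_mulmx -iterD.
apply: (@le_trans _ _ (rho ^+ (2 * n) * (fsq W * (C * x ^+ (2 * (n + m)))))).
  rewrite ler_wpM2l ?exprn_ge0 ?(ltW rho_gt0) //; apply: le_trans (fsqM_le _ _) _.
  by rewrite fsq_tr ler_wpM2l ?fsq_ge0 // fsq_HE_le.
have -> : C * C * x ^+ (2 * m) * x ^+ (2 * n) = C * (C * x ^+ (2 * (n + m))).
  by rewrite mulnDr exprD; ring.
have Cx0 : 0 <= C * x ^+ (2 * (n + m)).
  by rewrite mulr_ge0 ?exprn_ge0 // mulr_ge0 ?sqr_ge0.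
by rewrite [leLHS]mulrA; apply: ler_wpM2r.
Qed.

Lemma residue_symm : E^T = E.
Proof.
have : (E - 1%:M)^T *m E = 0 := residue_orth 0.
rewrite linearB /= trmx1 mulmxBl mul1mx => /subr0_eq EE.
by rewrite -[in LHS]EE trmx_mul trmxK EE.
Qed.

Lemma residue_idem : E *m E = E.
Proof.
have : (E - 1%:M)^T *m E = 0 := residue_orth 0.
by rewrite linearB /= trmx1 residue_symm mulmxBl mul1mx => /subr0_eq.
Qed.

Lemma residue_comm : E *m H = H *m E.
Proof.
have : (E - 1%:M)^T *m (H *m E) = 0 := residue_orth 1.
rewrite linearB /= trmx1 residue_symm mulmxBl mul1mx => /subr0_eq EHE.
have -> : E *m H = (H *m E)^T by rewrite trmx_mul symH residue_symm.
by rewrite -[RHS]EHE -[in LHS]EHE !trmx_mul symH residue_symm mulmxA.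
Qed.

(** On the range of E an orbit of H is O(x^n), so it cannot grow at rate rho. *)
Lemma residue_range_eq0 (v : 'cV[R]_d) :
  E *m v = v -> rho ^+ 2 * fsq v <= fsq (H *m v) -> v = 0.
Proof.
move=> Ev Hv; apply/fsq_eq0; rewrite le_eqVlt; apply/orP; left; apply/eqP.
apply: (@geometric_le_eq0 _ _ ((d * d)%:R * K ^+ 2 * fsq v) x rho) => [||n] //.
  exact: fsq_ge0.
rewrite exprM; apply: le_trans (fsq_iter_ge symH n (sqr_ge0 _) Hv) _.
rewrite -[X in iter _ _ X]Ev -iter_mulmxA; apply: le_trans (fsqM_le _ _) _.
by rewrite mulrAC ler_wpM2r ?fsq_ge0 // fsq_HE_le.
Qed.

(** A vector v in the kernel of E is H^n y with y = - W_n v = O(rho^(-n)).  If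
    H grew v by a factor at most x, then by log-convexity it would have grown y
    by at most x at each of the n earlier steps, so |v| <= x^n |y|. *)
Lemma residue_ker_eq0 (v : 'cV[R]_d) :
  E *m v = 0 -> fsq (H *m v) <= x ^+ 2 * fsq v -> v = 0.
Proof.
move=> Ev Hv; apply/fsq_eq0; rewrite le_eqVlt; apply/orP; left; apply/eqP.
apply: (@geometric_le_eq0 _ _ ((d * d)%:R * K ^+ 2 * fsq v) x rho) => [||n] //.
  exact: fsq_ge0.
have [W EW W_le] := EI_rangeP n.
have vW : v = iter n (mulmx H) (W *m (- v)).
  by rewrite -iter_mulmxA -EW mulmxN mulmxBl mul1mx Ev sub0r opprK.
have := @fsq_iter_le _ _ _ _ symH (x ^+ 2) n (W *m - v) (sqr_ge0 _).
rewrite iterS -vW => /(_ Hv) v_le.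
have r0 : 0 <= rho ^+ (2 * n) by rewrite exprn_ge0 // ltW.
apply: le_trans (ler_wpM2l r0 v_le) _; rewrite -exprM mulrCA mulrC.
rewrite ler_wpM2r ?exprn_ge0 //.
apply: le_trans (ler_wpM2l r0 (fsqM_le _ _)) _.
by rewrite fsqN mulrA ler_wpM2r ?fsq_ge0.
Qed.

(** If E v = 0 then v = - W_n^T H^n v, which is O((|mu| / rho)^n). *)
Lemma residue_ker_eigen (v : 'cV[R]_d) mu :
  H *m v = mu *: v -> E *m v = 0 -> v != 0 -> rho <= `|mu|.
Proof.
move=> Hv Ev /eqP v0; rewrite leNgt; apply/negP => mu_rho; apply: v0.
apply/fsq_eq0; rewrite le_eqVlt; apply/orP; left; apply/eqP.
apply: (@geometric_le_eq0 _ _ ((d * d)%:R * K ^+ 2 * fsq v) `|mu| rho) => [||n] //.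
- exact: fsq_ge0.
- by rewrite normr_ge0.
have [W EW W_le] := EI_rangeP n.
have vE : fsq v = mu ^+ (2 * n) * fsq (W^T *m v).
  rewrite -[in LHS]fsqN.
  have -> : - v = (E - 1%:M)^T *m v.
    by rewrite linearB /= trmx1 residue_symm mulmxBl mul1mx Ev sub0r.
  rewrite EW tr_iter_mulmx (iter_mulmx_eigen _ Hv) -scalemxAr fsqZ.
  by rewrite -exprM mulnC.
have r0 : 0 <= rho ^+ (2 * n) by rewrite exprn_ge0 // ltW.
have -> : `|mu| ^+ (2 * n) = mu ^+ (2 * n).
  by rewrite !exprM real_normK ?num_real.
have m0 : 0 <= mu ^+ (2 * n) by rewrite exprM exprn_ge0 ?sqr_ge0.
rewrite [in leLHS]vE mulrCA mulrC ler_wpM2r //.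
apply: le_trans (ler_wpM2l r0 (fsqM_le _ _)) _.
by rewrite fsq_tr mulrA ler_wpM2r ?fsq_ge0.
Qed.

(** Here mu^n E v = (H^n E)^T v, which is O(x^n). *)
Lemma residue_eigen_eq0 (v : 'cV[R]_d) mu :
  H *m v = mu *: v -> x < `|mu| -> E *m v = 0.
Proof.
move=> Hv x_mu; apply/fsq_eq0; rewrite le_eqVlt; apply/orP; left; apply/eqP.
apply: (@geometric_le_eq0 _ _ ((d * d)%:R * K ^+ 2 * fsq v) x `|mu|) => [||n] //.
- exact: fsq_ge0.
- by rewrite x_ge0.
have -> : `|mu| ^+ (2 * n) * fsq (E *m v)
    = fsq ((iter n (mulmx H) E)^T *m v).
  rewrite tr_iter_mulmx (iter_mulmx_eigen _ Hv) -scalemxAr fsqZ residue_symm.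
  by rewrite !exprM real_normK ?num_real // -!exprM mulnC.
apply: le_trans (fsqM_le _ _) _.
by rewrite fsq_tr mulrAC ler_wpM2r ?fsq_ge0 // fsq_HE_le.
Qed.

End GeometricProjector.

(** * Counting eigenvalues through the characteristic polynomial *)

Section DeflatedCharPoly.
Variables (K : fieldType).

(** Sylvester's identity: both sides are the determinant of the block matrix
    with rows (1, U) and (- V, 1), reduced in two ways. *)
Lemma det_1D_mulmxC (S : comPzRingType) m n (U : 'M[S]_(m, n))
    (V : 'M[S]_(n, m)) :
  \det (1%:M + U *m V) = \det (1%:M + V *m U).
Proof.
have E1 : block_mx 1%:M (- U) 0 1%:M *m block_mx 1%:M U (- V) 1%:M
    = block_mx (1%:M + U *m V) 0 (- V) 1%:M.
  rewrite mulmx_block !mul1mx !mul0mx !mulmx1 mulNmx mulmxN opprK.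
  by rewrite subrr !add0r.
have E2 : block_mx 1%:M 0 V 1%:M *m block_mx 1%:M U (- V) 1%:M
    = block_mx 1%:M U 0 (1%:M + V *m U).
  rewrite mulmx_block !mul1mx !mul0mx !mulmx1 !addr0 subrr.
  by rewrite addrC.
have := congr1 determinant E1; have := congr1 determinant E2.
rewrite !det_mulmx !det_ublock !det_lblock !det1 !mul1r !mulr1 => -> ->.
by [].
Qed.

Lemma size_det_le n (M : 'M[{poly K}]_n) :
  (forall i j, size (M i j) <= 2)%N -> (size (\det M) <= n.+1)%N.
Proof.
have sizeN_if b (p : {poly K}) : size (if b then - p else p) = size p.
  by case: b; rewrite ?size_polyN.
move=> M_le; apply: (leq_trans (size_sum _ _ _)); apply/bigmax_leqP => s _.
rewrite mulr_sign sizeN_if.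
apply: leq_trans (size_poly_prod_leq _ _) _; rewrite card_ord leq_subLR addnS.
rewrite ltnS; apply: (@leq_trans (\sum_(i < n) 2)); first exact: leq_sum.
by rewrite sum_nat_const card_ord muln2 addnn.
Qed.

Variables (d : nat) (H E : 'M[K]_d).
Hypotheses (idE : E *m E = E) (commE : E *m H = H *m E).

Let C := char_poly_mx H.
Let Ep := map_mx polyC E.

(** These are the characteristic polynomials of H on the range and on the
    kernel of E.  They are written as determinants of size d, by letting the
    identity act on the complementary subspace, to avoid choosing bases of the
    two subspaces. *)
Definition char_poly_on : {poly K} := \det (C *m Ep + (1%:M - Ep)).
Definition char_poly_off : {poly K} := \det (Ep + C *m (1%:M - Ep)).

(** The two matrices multiply to the characteristic matrix of H, because E is an
    idempotent commuting with it. *)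
Lemma char_poly_split : char_poly H = char_poly_on * char_poly_off.
Proof.
rewrite /char_poly_on /char_poly_off -det_mulmx -/C; congr (\det _).
have EpEp : Ep *m Ep = Ep by rewrite -map_mxM idE.
have EpC : Ep *m C = C *m Ep.
  rewrite /C /char_poly_mx mulmxBr mulmxBl scalar_mxC -!map_mxM.
  by rewrite commE.
set N := 1%:M - Ep; have EN : Ep *m N = 0 by rewrite mulmxBr mulmx1 EpEp subrr.
have NE : N *m Ep = 0 by rewrite mulmxBl mul1mx EpEp subrr.
have NN : N *m N = N by rewrite {1}/N mulmxBl mul1mx EN subr0.
have NC : N *m C = C *m N by rewrite /N [LHS]mulmxBl [RHS]mulmxBr mul1mx mulmx1 EpC.
have NE1 : N + Ep = 1%:M by rewrite subrK.
clearbody N.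
have CECN : C *m Ep *m (C *m N) = 0.
  by rewrite -mulmxA (mulmxA Ep) EpC -mulmxA EN !mulmx0.
have NCN : N *m (C *m N) = C *m N by rewrite mulmxA NC -mulmxA NN.
rewrite mulmxDl !mulmxDr NE add0r CECN addr0 NCN -mulmxA EpEp -mulmxDr.
by rewrite addrC NE1 mulmx1.
Qed.

(** Factoring E through a space of dimension its rank, Sylvester's identity
    turns the determinant into one of that smaller size with entries of degree at
    most 1. *)
Lemma size_char_poly_on : (size char_poly_on <= (\rank E).+1)%N.
Proof.
pose U := map_mx polyC (col_base E); pose V := map_mx polyC (row_base E).
have EpE : Ep = U *m V by rewrite -map_mxM mulmx_base.
have -> : char_poly_on = \det (1%:M + V *m ((C - 1%:M) *m U)).
  rewrite -det_1D_mulmxC -mulmxA -EpE; congr (\det _).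
  by rewrite (mulmxBl C 1%:M) mul1mx addrCA.
apply: size_det_le => i j.
have -> : V *m ((C - 1%:M) *m U) = 'X *: map_mx polyC (row_base E *m col_base E)
    - map_mx polyC (row_base E *m (H + 1%:M) *m col_base E).
  rewrite /U /V; move: (row_base E) (col_base E) => rb cb.
  rewrite !map_mxM map_mxD map_mx1.
  have -> : C - 1%:M = 'X%:M - (map_mx polyC H + 1%:M) by rewrite opprD addrA.
  by rewrite mulmxBl mulmxBr mul_scalar_mx -scalemxAr mulmxA.
rewrite !mxE; set a := (\sum_j _); set b := (\sum_j _).
rewrite addrA; apply: leq_trans (size_polyD _ _) _.
rewrite geq_max size_polyN (leq_trans (size_polyC_leq1 _)) // andbT.
apply: leq_trans (size_polyD _ _) _; rewrite geq_max; apply/andP; split.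
  by case: (i == j); rewrite ?size_poly1 ?size_poly0.
apply: leq_trans (size_polyMleq _ _) _.
by rewrite size_polyX /= ltnS size_polyC_leq1.
Qed.

Lemma root_char_poly_off mu : root char_poly_off mu ->
  exists2 v : 'rV_d, v != 0 & v *m E = 0 /\ v *m H = mu *: v.
Proof.
rewrite /root /char_poly_off -horner_evalE -det_map_mx => /det0P[v v0].
have -> : map_mx (horner_eval mu) (Ep + C *m (1%:M - Ep))
    = E + (mu%:M - H) *m (1%:M - E).
  have hE M : map_mx (horner_eval mu) (map_mx polyC M) = M :> 'M[K]_d.
    by apply/matrixP => i j; rewrite !mxE horner_evalE hornerC.
  rewrite map_mxD map_mxM !map_mxB map_mx1 !hE; congr (_ + (_ - _) *m _).
  by rewrite map_scalar_mx /= horner_evalE hornerX.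
move=> vEq; have vE : v *m E = 0.
  have NE : (1%:M - E) *m E = 0 by rewrite mulmxBl mul1mx idE subrr.
  have := congr1 (mulmx^~ E) vEq; rewrite mul0mx -mulmxA mulmxDl idE -mulmxA.
  by rewrite NE mulmx0 addr0.
exists v => //; split=> //; move: vEq.
have -> : (mu%:M - H) *m (1%:M - E) = (1%:M - E) *m (mu%:M - H).
  have muE : (mu%:M - H) *m E = E *m (mu%:M - H).
    by rewrite mulmxBl mulmxBr commE scalar_mxC.
  by rewrite (mulmxBr (mu%:M - H)) (mulmxBl 1%:M) mulmx1 mul1mx muE.
rewrite mulmxDr vE add0r mulmxA (mulmxBr v 1%:M) mulmx1 vE subr0 mulmxBr.
by rewrite mul_mx_scalar => /subr0_eq.
Qed.

End DeflatedCharPoly.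

Section RootCounting.
Variable K : fieldType.

(** The factor of the characteristic polynomial coming from the kernel of E has
    degree at least r and no small root.  If some mu_i were small, all the nu_j
    would be small too, and this factor would divide the product of the other
    r - 1 linear factors. *)
Lemma leading_roots_not_small d r (H E : 'M[K]_d) (mu : 'rV[K]_r) (nu : 'rV[K]_(d - r))
    (small : pred K) :
    E *m E = E -> E *m H = H *m E -> (\rank E + r <= d)%N ->
    char_poly H = (\prod_(i < r) ('X - (mu 0 i)%:P)) *
                  (\prod_(j < d - r) ('X - (nu 0 j)%:P)) ->
    (forall z, root (char_poly_off H E) z -> ~~ small z) ->
    (forall i j, small (mu 0 i) -> small (nu 0 j)) ->
  forall i, ~~ small (mu 0 i).
Proof.
move=> idE commE rankE charH off_small mu_nu i0; apply/negP => small0.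
have splitH := char_poly_split idE commE.
set p := char_poly_on H E in splitH; set q := char_poly_off H E in splitH off_small.
have pq0 : p * q != 0 by rewrite -splitH monic_neq0 ?char_poly_monic.
have [p0 q0] : p != 0 /\ q != 0 by apply/andP; rewrite -negb_or -mulf_eq0.
have size_q : (r < size q)%N.
  have := size_char_poly H; rewrite splitH size_mul // => size_pq.
  have := size_char_poly_on H E; rewrite -/p => size_p.
  have : (size p + size q = d.+2)%N.
    by rewrite -size_pq prednK // addn_gt0 lt0n size_poly_eq0 p0.
  by move: rankE size_p; lia.
have cop z : small z -> coprimep q ('X - z%:P).
  by move=> sz; rewrite coprimep_XsubC; apply/negP => /off_small; rewrite sz.
have q_dvd : q %| \prod_(i < r | i != i0) ('X - (mu 0 i)%:P).
  have : q %| char_poly H by rewrite splitH dvdp_mull.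
  rewrite charH Gauss_dvdpl; last first.
    elim/big_ind: _ => [|a b ca cb|j _]; first exact: coprimep1.
      by rewrite coprimepMr ca.
    by apply: cop; apply: mu_nu small0.
  by rewrite (bigD1 i0) //= Gauss_dvdpr ?cop.
have size_all : size (\prod_(i < r) ('X - (mu 0 i)%:P)) = r.+1.
  by rewrite size_prod_XsubC /index_enum -enumT size_enum_ord.
set p' := (\prod_(i < r | _) _) in q_dvd.
have p'0 : p' != 0 by apply/prodf_neq0 => i _; rewrite polyXsubC_eq0.
move: size_all; rewrite (bigD1 i0) //= -/p' size_monicM ?monicXsubC //.
rewrite size_XsubC add2n => -[size_p'].
by have := dvdp_leq p'0 q_dvd; rewrite size_p' leqNgt size_q.
Qed.

(** The condition is on transposed columns because the norm estimates concern
    column vectors while row spaces carry the rank calculus. *)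
Lemma rank_disjoint_le d m n (A : 'M[K]_(m, d)) (B : 'M[K]_(n, d)) :
    (forall v : 'cV_d, (v^T <= A)%MS -> (v^T <= B)%MS -> v = 0) ->
  (\rank A + \rank B <= d)%N.
Proof.
move=> AB0; rewrite -mxrank_disjoint_sum ?rank_leq_col //.
apply/eqP/rowV0P => v; rewrite sub_capmx => /andP[vA vB].
by rewrite -[v]trmxK (AB0 v^T) ?trmxK ?trmx0.
Qed.

Lemma orthonormal_rank d r (T : 'M[K]_(d, r)) :
  T^T *m T = 1%:M -> \rank T^T = r.
Proof. by move=> TT; apply/eqP/row_freeP; exists T. Qed.

(** T^T = T^T G puts the rows of T^T in the row space of G, and the ranks force
    equality. *)
Lemma projector_onto_columns d r (T : 'M[K]_(d, r)) (G : 'M[K]_d) :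
    T^T *m T = 1%:M -> G^T = G -> G *m T = T -> (\rank G <= r)%N ->
  G = T *m T^T.
Proof.
move=> TT symG GT rankG.
have sTG : (T^T <= G)%MS.
  by apply/submxP; exists T^T; rewrite -[in LHS]GT trmx_mul symG.
have : (G <= T^T)%MS.
  by rewrite -(geq_leqif (mxrank_leqif_sup sTG)) orthonormal_rank.
case/submxP => D GD; rewrite -[X in _ = X *m _]GT GD.
by rewrite -!mulmxA [T^T *m (T *m _)]mulmxA TT mul1mx.
Qed.

End RootCounting.

(** * Cauchy products as sums over tuples *)

Section CauchyProducts.
Variables (R : pzRingType) (d : nat).
Implicit Types (G u : nat -> 'M[R]_d) (X : 'M[R]_d).

Definition cauchy_mul G u n : 'M[R]_d := \sum_(a < n.+1) G a *m u (n - a)%N.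

(** The coefficients of the matrix power series G (X G)^k. *)
Fixpoint resolvent_coeff G X k : nat -> 'M[R]_d :=
  if k is k'.+1 then cauchy_mul G (fun n => X *m resolvent_coeff G X k' n)
  else G.

(** The assumptions on G state that (z - A) G(z) = z; multiplying this identity
    by u(z) on the right gives the conclusion. *)
Lemma cauchy_mul_resolvent (A : 'M[R]_d) G u :
    A *m G 0 = 0 -> (forall n, G n - A *m G n.+1 = (n == 0)%:R%:M) ->
  A *m cauchy_mul G u 0 = 0 /\
  forall n, cauchy_mul G u n - A *m cauchy_mul G u n.+1 = u n.
Proof.
move=> AG0 AGS; split=> [|n].
  by rewrite /cauchy_mul big_ord1 mulmxA AG0 mul0mx.
rewrite /cauchy_mul [in X in _ - _ *m X]big_ord_recl mulmxDr mulmxA AG0 mul0mx.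
rewrite add0r mulmx_sumr -sumrB (eq_bigr (fun a : 'I_n.+1 =>
  ((a : nat) == 0)%:R%:M *m u (n - a)%N)).
  rewrite big_ord_recl /= mul1mx subn0 big1 ?addr0 // => a _.
  by rewrite mulr0n raddf0 mul0mx.
by move=> a _; rewrite -AGS mulmxBl mulmxA /= /bump add1n subSS.
Qed.

Section Tuples.
Variables (G : nat -> 'M[R]_d) (X : 'M[R]_d) (B : nat).

Definition ffun_cons k (T : Type) (a : T) (s : {ffun 'I_k -> T}) :
    {ffun 'I_k.+1 -> T} :=
  [ffun i => oapp s a (unlift ord0 i)].

Lemma big_ffun_recl (V : nmodType) k (T : finType)
    (f : {ffun 'I_k.+1 -> T} -> V) :
  \sum_s f s = \sum_a \sum_(s : {ffun 'I_k -> T}) f (ffun_cons a s).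
Proof.
rewrite pair_big /= (reindex (fun p => ffun_cons p.1 p.2)) //=.
exists (fun s => (s ord0, [ffun j => s (lift ord0 j)])) => [[a s]|s] _ /=.
  congr pair; first by rewrite ffunE unlift_none.
  by apply/ffunP => j; rewrite !ffunE liftK.
apply/ffunP => i; rewrite ffunE.
by case: unliftP => [j|] -> //=; rewrite ffunE.
Qed.

(** The coefficient of z^n in (X G(z))^k, as long as n <= B: the bound B makes the
    set of tuples finite, with an entry type that does not vary with k and n. *)
Definition tuple_coeff k n : 'M[R]_d :=
  \sum_(s : {ffun 'I_k -> 'I_B.+1} | (\sum_j s j)%N == n)
    \big[mulmx/1%:M]_(j < k) (X *m G (s j)).

(** Splitting off the first entry a of the tuple leaves a shorter tuple of sum
    n - a: this is how sums over tuples turn into Cauchy products. *)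
Lemma sum_tuples_recl (M : nat -> 'M[R]_d) k n : (n <= B)%N ->
  \sum_(s : {ffun 'I_k.+1 -> 'I_B.+1} | (\sum_j s j)%N == n)
    (M (s ord0) *m \big[mulmx/1%:M]_(j < k) (X *m G (s (lift ord0 j))))
  = cauchy_mul M (tuple_coeff k) n.
Proof.
move=> nB; rewrite big_mkcond big_ffun_recl /cauchy_mul.
rewrite (big_ord_widen B.+1 (fun a => M a *m tuple_coeff k (n - a)%N)) //.
rewrite [RHS]big_mkcond; apply: eq_bigr => a _.
rewrite ltnS /tuple_coeff mulmx_sumr.
have consS s : (\sum_j (ffun_cons a s) j = a + \sum_j s j)%N.
  rewrite big_ord_recl ffunE unlift_none; congr addn.
  by apply: eq_bigr => j _; rewrite ffunE liftK.
case: leqP => an; last first.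
  apply: big1 => s _; rewrite consS ifN //.
  by apply/eqP => sn; move: an; rewrite -sn ltnNge leq_addr.
rewrite [RHS]big_mkcond; apply: eq_bigr => s _.
rewrite consS -[X in _ == X](subnKC an) eqn_add2l; case: eqP => // _.
congr (_ *m _); first by rewrite ffunE unlift_none.
by apply: eq_bigr => j _; rewrite ffunE liftK.
Qed.

Lemma tuple_coeff0 n : tuple_coeff 0 n = (n == 0)%:R%:M.
Proof.
rewrite /tuple_coeff big_mkcond (eq_bigr (fun=> (n == 0)%:R%:M)).
  by rewrite sumr_const card_ffun !card_ord expn0.
by move=> s _; rewrite !big_ord0 eq_sym; case: eqP; rewrite ?mulr0n ?raddf0.
Qed.

Lemma tuple_coeffS k n : (n <= B)%N ->
  tuple_coeff k.+1 n = cauchy_mul (fun a => X *m G a) (tuple_coeff k) n.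
Proof.
move=> nB; rewrite -sum_tuples_recl //; apply: eq_bigr => s _.
by rewrite big_ord_recl.
Qed.

Lemma resolvent_coeff_cauchy k n : (n <= B)%N ->
  resolvent_coeff G X k n = cauchy_mul G (tuple_coeff k) n.
Proof.
elim: k n => [|k IHk] n nB.
  rewrite /= /cauchy_mul big_ord_recr /= subnn tuple_coeff0 mulmx1.
  rewrite big1 ?add0r // => a _; rewrite tuple_coeff0 subn_eq0 leqNgt ltn_ord.
  by rewrite mulr0n raddf0 mulmx0.
rewrite /= /cauchy_mul; apply: eq_bigr => a _; congr (_ *m _).
have naB : (n - a <= B)%N by rewrite (leq_trans (leq_subr _ _)).
rewrite tuple_coeffS // IHk // /cauchy_mul mulmx_sumr.
by apply: eq_bigr => b _; rewrite mulmxA.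
Qed.

Lemma resolvent_coeff_sum k n : (n <= B)%N ->
  resolvent_coeff G X k n
  = \sum_(s : {ffun 'I_k.+1 -> 'I_B.+1} | (\sum_j s j)%N == n)
      (G (s ord0) *m \big[mulmx/1%:M]_(j < k) (X *m G (s (lift ord0 j)))).
Proof. by move=> nB; rewrite sum_tuples_recl // resolvent_coeff_cauchy. Qed.

End Tuples.
End CauchyProducts.

Lemma big_mulmx_scale (R : comPzRingType) d k (c : 'I_k -> R)
    (M : 'I_k -> 'M[R]_d) :
  \big[mulmx/1%:M]_(j < k) (c j *: M j)
  = (\prod_(j < k) c j) *: \big[mulmx/1%:M]_(j < k) M j.
Proof.
elim: k c M => [|k IHk] c M; first by rewrite !big_ord0 scale1r.
by rewrite !big_ord_recl IHk -scalemxAl -scalemxAr scalerA.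
Qed.

Lemma sign_npos (R : comPzRingType) n m (s : {ffun 'I_n -> 'I_m}) :
  (-1) ^+ npos s = \prod_j (-1) ^+ (0 < s j)%N :> R.
Proof.
rewrite prodrXr /npos -sum1_card big_mkcond; congr (_ ^+ _).
by apply: eq_bigr => j _; rewrite unfold_in /= asboolb; case: (0 < s j)%N.
Qed.

(** The coefficients of z (z - A)^-1 at 0. *)
Definition signed_frakP (R : realType) (d r : nat) (T : 'M[R]_(d, r))
    (T' : 'M[R]_(d, d - r)) (lam : 'rV[R]_r) (m : nat) : 'M[R]_d :=
  (-1) ^+ (0 < m)%N *: frakP T T' lam m.

(** Distributing one sign over each positive entry of the tuple produces
    (-1)^tau(s). *)
Lemma pert_termE (R : realType) d r (T : 'M[R]_(d, r)) (T' : 'M[R]_(d, d - r))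
    (lam : 'rV[R]_r) (X : 'M[R]_d) k :
  pert_term T T' lam X k
  = - resolvent_coeff (signed_frakP T T' lam) X k k.
Proof.
rewrite (resolvent_coeff_sum _ _ _ (leqnn k)) -sumrN; apply: eq_bigr => s _.
rewrite addSn add0n exprS mulN1r scaleNr; congr (- _).
rewrite sign_npos big_ord_recl /signed_frakP.
under [in RHS]eq_bigr do rewrite -scalemxAr.
by rewrite big_mulmx_scale -scalemxAl -scalemxAr scalerA.
Qed.

(** * The perturbed projector *)

Section UnperturbedSpectrum.
Variables (R : realType) (d r : nat) (lam : 'rV[R]_r).
Variables (T : 'M[R]_(d, r)) (T' : 'M[R]_(d, d - r)).
Hypothesis lam_neq0 : forall i, lam 0 i != 0.
Hypothesis completion : orthogonal_completion T T'.

Let A := T *m diag_mx lam *m T^T.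
Let G := signed_frakP T T' lam.

Lemma completion_sum : T *m T^T + T' *m T'^T = 1%:M.
Proof. by case: completion => _; rewrite tr_row_mx mul_row_col. Qed.

Lemma completion_blocks :
  [/\ T^T *m T = 1%:M, T^T *m T' = 0 & T'^T *m T' = 1%:M].
Proof.
case: completion => + _; rewrite tr_row_mx mul_col_row scalar_mx_block.
by move=> /eq_block_mx[].
Qed.

Lemma mulmx_signed_frakPSS m : A *m G m.+2 = G m.+1.
Proof.
have [TT _ _] := completion_blocks.
rewrite /G /signed_frakP /= !scaleN1r mulmxN /A; congr (- _).
rewrite -!mulmxA (mulmxA T^T T) TT mul1mx; congr (_ *m _).
rewrite mulmxA mulmx_diag; congr (diag_mx _ *m _).
apply/rowP => j; rewrite !mxE [lam 0 j ^+ m.+2]exprS invfM mulrA.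
by rewrite mulfV // mul1r.
Qed.

Lemma signed_frakP_resolvent n : G n - A *m G n.+1 = (n == 0)%:R%:M.
Proof.
case: n => [|n]; last by rewrite mulmx_signed_frakPSS subrr mulr0n raddf0.
have [TT _ _] := completion_blocks.
rewrite /G /signed_frakP /= scale1r scaleN1r mulmxN opprK /A.
rewrite -!mulmxA (mulmxA T^T T) TT mul1mx (mulmxA (diag_mx _)) mulmx_diag.
rewrite addrC -completion_sum; congr (_ *m _ + _).
have -> : \row_j (lam 0 j * (\row_j0 (lam 0 j0)^-1) 0 j) = const_mx 1.
  by apply/rowP => j; rewrite !mxE mulfV.
by rewrite diag_const_mx mul1mx.
Qed.

Lemma mulmx_signed_frakP0 : A *m G 0 = 0.
Proof.
have [_ TT' _] := completion_blocks.
by rewrite /G /signed_frakP /= scale1r /A -!mulmxA (mulmxA T^T) TT' mul0mx !mulmx0.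
Qed.

Lemma A_expand_range p (rho : R) (v : 'M[R]_(d, p)) :
    0 <= rho -> (forall i, 2 * rho <= `|lam 0 i|) ->
  4 * rho ^+ 2 * fsq (T *m T^T *m v) <= fsq (A *m v).
Proof.
move=> rho0 lam_ge; have [TT _ _] := completion_blocks.
rewrite /A -!mulmxA !(fsq_isometry _ TT); set w := T^T *m v.
rewrite mul_diag_mx !fsqE mulr_sumr; apply: ler_sum => i _.
rewrite mulr_sumr; apply: ler_sum => j _.
rewrite [X in _ <= X ^+ 2]mxE exprMn.
rewrite ler_wpM2r ?sqr_ge0 // -[leRHS]real_normK ?num_real //.
have -> : 4 * rho ^+ 2 = (2 * rho) ^+ 2 by ring.
by rewrite lerXn2r ?nnegrE // mulr_ge0.
Qed.

End UnperturbedSpectrum.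

(** The value x + 1 only serves for r = 0, where the minimum over the empty
    family is infinite. *)
Lemma spectral_gap_radius (R : realType) r (lam : 'rV[R]_r) (x : R) :
    (x%:E < \big[Order.min/+oo]_(i < r) (`|lam 0 i| / 2)%:E)%E ->
  exists2 rho, x < rho & forall i, 2 * rho <= `|lam 0 i|.
Proof.
move=> x_lt; pose m := \big[Order.min/(x + 1)]_(i < r) (`|lam 0 i| / 2).
exists m.
  apply: lt_bigmin => [|i _]; first by rewrite ltrDl.
  rewrite -lte_fin; apply: lt_le_trans x_lt _.
  exact: (bigmin_le_cond _ (fun i : 'I_r => (`|lam 0 i| / 2)%:E)).
move=> i; rewrite mulrC -ler_pdivlMr //.
by apply: bigmin_le_cond.
Qed.

Section PerturbedProjector.
Variables (R : realType) (d r : nat) (lam : 'rV[R]_r) (X : 'M[R]_d).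
Variables (T : 'M[R]_(d, r)) (T' : 'M[R]_(d, d - r)) (rho : R).
Hypothesis r_le_d : (r <= d)%N.
Hypothesis symX : X^T = X.
Hypothesis lam_neq0 : forall i, lam 0 i != 0.
Hypothesis completion : orthogonal_completion T T'.
Hypothesis X_lt : opnorm X < rho.
Hypothesis lam_ge : forall i, 2 * rho <= `|lam 0 i|.

Let A := T *m diag_mx lam *m T^T.
Let H := A + X.

Lemma perturbed_symm : H^T = H.
Proof. by rewrite linearD /= symX /A !trmx_mul trmxK tr_diag_mx mulmxA. Qed.

(** On the span of Theta, A expands by 2 rho and X contributes less than rho. *)
Lemma fsq_perturbed_range_ge (v : 'cV[R]_d) :
  T *m T^T *m v = v -> rho ^+ 2 * fsq v <= fsq (H *m v).
Proof.
move=> Tv; have x0 := opnorm_ge0 X.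
have rho0 : 0 <= rho by rewrite ltW // (le_lt_trans x0).
have := A_expand_range completion v rho0 lam_ge; rewrite Tv -/A => Av.
have := fsqB_le (H *m v) (X *m v); rewrite -mulmxBl addrK => HXv.
have := fsqM_opnorm X v => Xv.
have x2 : opnorm X ^+ 2 <= rho ^+ 2 by rewrite lerXn2r ?nnegrE // ltW.
have := ler_wpM2r (fsq_ge0 v) x2; lra.
Qed.

(** On the span of Theta_perp, A vanishes and H coincides with X. *)
Lemma fsq_perturbed_kernel_le (z : 'cV[R]_(d - r)) :
  fsq (H *m (T' *m z)) <= opnorm X ^+ 2 * fsq (T' *m z).
Proof.
have [_ TT' _] := completion_blocks completion.
rewrite mulmxDl /A -!mulmxA (mulmxA T^T) TT' mul0mx !mulmx0 add0r.
exact: fsqM_opnorm.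
Qed.

Lemma leading_projector_series (U : 'M[R]_(d, r)) :
    leading_eigenvectors H U ->
  mx_cvg (fun N => \sum_(k < N)
            resolvent_coeff (signed_frakP T T' lam) X k k)
         (1%:M - U *m U^T).
Proof.
move=> [UU [mu [nu [charH mu_nu HU]]]].
have symH := perturbed_symm; have x0 := opnorm_ge0 X.
have x_rho : 0 <= opnorm X < rho by rewrite x0.
have rho0 : 0 < rho := le_lt_trans x0 X_lt.
have [TT TT' T'T'] := completion_blocks completion.
set G := signed_frakP T T' lam; set F := resolvent_coeff G X.
have AG0 : A *m G 0 = 0 := mulmx_signed_frakP0 lam completion.
have AGS n : G n - A *m G n.+1 = (n == 0)%:R%:M.
  exact: signed_frakP_resolvent.
have FS k := cauchy_mul_resolvent (fun n => X *m F k n) AG0 AGS.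
have AF0 k : A *m F k 0 = 0 by case: k => // k; case: (FS k).
have FSS k n : F k.+1 n - A *m F k.+1 n.+1 = X *m F k n.
  by case: (FS k) => _; apply.
have symP : (T *m T^T)^T = T *m T^T by rewrite trmx_mul trmxK.
have idP : T *m T^T *m (T *m T^T) = T *m T^T.
  by rewrite -mulmxA (mulmxA T^T) TT mul1mx.
have PA : T *m T^T *m A = A by rewrite /A !mulmxA -(mulmxA T) TT mulmx1.
have F_le := coeff_entry_le symP idP PA rho0
  (fun p v => A_expand_range completion v (ltW rho0) lam_ge) AF0 AGS FSS.
have [E cvgE [K [HE_le EI_range]]] := resolvent_residue AF0 AGS FSS x_rho F_le.
have symE := residue_symm symH x_rho HE_le EI_range.
have idE := residue_idem symH x_rho HE_le EI_range.
have commE := residue_comm symH x_rho HE_le EI_range.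
(* The rest identifies E, first through its rank and then through its kernel. *)
suff <- : E = 1%:M - U *m U^T by [].
have rankE : (\rank E + r <= d)%N.
  rewrite -[X in (_ + X)%N](orthonormal_rank TT); apply: rank_disjoint_le => v.
  move=> /submxP[y vE] /submxP[z vT].
  have Ev : E *m v = v by rewrite -[v]trmxK vE trmx_mul mulmxA symE idE.
  apply: (residue_range_eq0 symH x_rho HE_le Ev).
  apply: fsq_perturbed_range_ge; rewrite -[v]trmxK vT trmx_mul trmxK mulmxA.
  by rewrite -(mulmxA T) TT mulmx1.
have rankEC : (\rank (1%:M - E)%R + (d - r) <= d)%N.
  rewrite -[X in (_ + X)%N](orthonormal_rank T'T'); apply: rank_disjoint_le => v.
  move=> /submxP[y vE] /submxP[z vT].
  have Ev : E *m v = 0.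
    rewrite -[v]trmxK vE trmx_mul linearB /= trmx1 symE mulmxA mulmxBr mulmx1.
    by rewrite idE subrr mul0mx.
  apply: (residue_ker_eq0 symH x_rho EI_range Ev).
  by rewrite -[v]trmxK vT trmx_mul trmxK fsq_perturbed_kernel_le.
(* The kernel vector comes as a row; both matrices being symmetric, its
   transpose is an eigenvector. *)
have off_small z : root (char_poly_off H E) z -> ~~ (`|z| < rho).
  move=> /(root_char_poly_off idE commE)[v v0 [vE vH]]; rewrite -leNgt.
  apply: (residue_ker_eigen symH x_rho HE_le EI_range (v := v^T)).
  - by rewrite -[H]symH -trmx_mul vH linearZ.
  - by rewrite -[E]symE -trmx_mul vE trmx0.
  - by rewrite -trmx0 (inj_eq trmx_inj).
have mu_ge i : rho <= `|mu 0 i|.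
  rewrite leNgt; apply: (leading_roots_not_small (small := fun z => `|z| < rho)
    idE commE rankE charH off_small) => {}i j.
  exact: le_lt_trans.
have EU : E *m U = 0.
  apply/matrixP => i j; have x_mu := lt_le_trans X_lt (mu_ge j).
  have := residue_eigen_eq0 symH x_rho HE_le EI_range (HU j) x_mu.
  rewrite colE mulmxA -colE => /(congr1 (fun v : 'cV_d => v i 0)).
  by rewrite !mxE.
have GE : 1%:M - E = U *m U^T.
  apply: projector_onto_columns => //.
  - by rewrite linearB /= trmx1 symE.
  - by rewrite mulmxBl mul1mx EU subr0.
  - by move: rankEC; lia.
by rewrite -GE opprB addrC subrK.
Qed.

End PerturbedProjector.

Theorem theorem1 (R : realType) (d r : nat) (A X : 'M[R]_d)
    (lam : 'rV[R]_r) (Theta : 'M[R]_(d, r)) (Theta_perp : 'M[R]_(d, d - r))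
    (hTheta : 'M[R]_(d, r)) :
  (r <= d)%N ->
  A^T = A ->
  X^T = X ->
  \rank A = r ->
  (forall i, lam 0 i != 0) ->
  (forall i j : 'I_r, (i <= j)%N -> lam 0 j <= lam 0 i) ->
  Theta^T *m Theta = 1%:M ->
  A = Theta *m diag_mx lam *m Theta^T ->
  orthogonal_completion Theta Theta_perp ->
  leading_eigenvectors (A + X) hTheta ->
  ((opnorm X)%:E < \big[Order.min/+oo]_(i < r) (`|lam 0 i| / 2)%:E)%E ->
  (fun n : nat => \sum_(1 <= k < n.+1) pert_term Theta Theta_perp lam X k) @ \oo
    --> hTheta *m hTheta^T - Theta *m Theta^T.
Proof.
move=> r_le_d _ symX _ lam_neq0 _ _ -> completion leading.
move=> /spectral_gap_radius[rho X_lt lam_ge].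
have cvgE := leading_projector_series r_le_d symX lam_neq0 completion X_lt
  lam_ge leading.
set F := resolvent_coeff _ X in cvgE.
apply: mx_cvg_topology.
have -> : hTheta *m hTheta^T - Theta *m Theta^T
    = Theta_perp *m Theta_perp^T + (- 1%:M) *m (1%:M - hTheta *m hTheta^T).
  rewrite mulNmx mul1mx opprB -(completion_sum completion) addrCA opprD.
  by rewrite [- _ - _]addrC addNKr.
have -> : (fun n => \sum_(1 <= k < n.+1) pert_term Theta Theta_perp lam X k)
    = (fun n => Theta_perp *m Theta_perp^T + (- 1%:M) *m \sum_(k < n.+1) F k k).
  apply/funext => n; rewrite mulNmx mul1mx big_ord_recl /= {1}/F /=.
  rewrite {1}/signed_frakP scale1r opprD addrA subrr add0r -sumrN.
  by rewrite big_add1 big_mkord; apply: eq_bigr => k _; rewrite pert_termE.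
apply: mx_cvgD; first exact: mx_cvg_cst.
apply: mx_cvgM; move/mx_cvg_shift: cvgE; exact.
Qed.
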